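(* Let $G$ be a group and $K$ a normal subgroup of $G$. If the quotient group $G/K$ is (Gromov) hyperbolic, then every $\varphi\in Q_{as}(K)^G$ extends to $G$, i.e. there is a quasimorphism $\Phi$ on $G$ with $\Phi|_K=\varphi$.
   Context: A quasimorphism on a group $G$ is a function $\varphi:G\to\mathbb R$ with finite defect $D(\varphi):=\sup_{g,h\in G}|\varphi(g)+\varphi(h)-\varphi(gh)|$. It is antisymmetric if $\varphi(g^{-1})=-\varphi(g)$ for all $g$. A quasimorphism $\varphi$ on a subgroup $K<G$ is $G$-quasi-invariant if $D^G(\varphi):=\sup\{|\varphi(k_1)-\varphi(k_2)| : k_1,k_2\in K\text{ conjugate in }G\}<\infty$. $Q_{as}(K)^G$ is the set of antisymmetric $G$-quasi-invariant quasimorphisms on $K$. *)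

(* Defs.v *)
From HB Require Import structures.
From mathcomp Require Import all_boot all_order all_algebra.
From mathcomp Require Import all_classical all_reals ereal.

Set Implicit Arguments.
Unset Strict Implicit.
Unset Printing Implicit Defensive.

Import Order.TTheory GRing.Theory Num.Theory.

Local Open Scope classical_set_scope.
Local Open Scope ring_scope.
Local Open Scope quotient_scope.

(* Conventions: a (possibly infinite) group is a groupType; a subgroup of G is
   a predicate on G with a groupClosed structure.  Predicates are boolean, which
   is no restriction classically, since asbool turns any Prop into a bool. *)

HB.mixin Record isConjClosed (G : groupType) (S : {pred G}) := {
  conj_closed_subproof : forall x y : G, x \in S -> (x ^ y)%g \in S
}.

#[short(type="normalClosed")]
HB.structure Definition NormalClosed (G : groupType) :=
  {S of isConjClosed G S & GroupClosed G S}.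

Section SubgroupType.
Variables (G : groupType) (K : groupClosed G).

Record subgroup := Subgroup {
  subgroup_val : G;
  subgroup_valP : subgroup_val \in K
}.

HB.instance Definition _ := [isSub for subgroup_val].
HB.instance Definition _ := [Choice of subgroup by <:].

Fact subgroup_group_closed : group_closed [in K].
Proof.
split; first exact: (@gpred1 _ K).
by move=> x y Kx Ky; apply: (@gpredF _ K).
Qed.

HB.instance Definition _ :=
  SubChoice_isSubGroup.Build G [in K] subgroup subgroup_group_closed.

End SubgroupType.

(* The quotient group G / K: its elements are the left cosets x K, and its
   operations are the ones induced from G through \pi_(quotient K). *)
Section QuotientGroup.
Variables (G : groupType) (K : normalClosed G).

Definition same_coset (x y : G) : bool := (x^-1 * y)%g \in K.

Fact same_coset_refl : reflexive same_coset.
Proof. by move=> x; rewrite /same_coset mulVg gpred1. Qed.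

Fact same_coset_sym : symmetric same_coset.
Proof. by move=> x y; rewrite /same_coset -gpredV invgM invgK. Qed.

Fact same_coset_trans : transitive same_coset.
Proof.
move=> y x z xy yz; rewrite /same_coset.
by have := gpredM _ _ xy yz; rewrite -mulgA mulVKg.
Qed.

Canonical same_coset_equiv :=
  EquivRel same_coset same_coset_refl same_coset_sym same_coset_trans.

Definition quotient := {eq_quot same_coset}.

HB.instance Definition _ := Choice.on quotient.
HB.instance Definition _ := EqQuotient.on quotient.

Definition quotient_mul : quotient -> quotient -> quotient :=
  lift_op2 quotient (fun x y : G => (x * y)%g).
Definition quotient_inv : quotient -> quotient :=
  lift_op1 quotient (fun x : G => x^-1%g).
Definition quotient_one : quotient := lift_cst quotient 1%g.

Lemma quotient_piP (x y : G) :
  reflect (x = y %[mod quotient]) ((x^-1 * y)%g \in K).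
Proof. exact: (@eqmodP _ same_coset_equiv x y). Qed.

Lemma quotient_mulE (x y : G) :
  quotient_mul (\pi_quotient x) (\pi_quotient y) = \pi_quotient (x * y)%g.
Proof.
rewrite /quotient_mul; unlock; apply/quotient_piP.
set x' := repr _; set y' := repr _.
have xx' : (x'^-1 * x)%g \in K by apply/quotient_piP; rewrite reprK.
have yy' : (y'^-1 * y)%g \in K by apply/quotient_piP; rewrite reprK.
have -> : ((x' * y')^-1 * (x * y) = (x'^-1 * x) ^ y' * (y'^-1 * y))%g.
  by rewrite /conjg invgM !mulgA mulgK.
by rewrite gpredM//; apply: conj_closed_subproof.
Qed.

Lemma quotient_invE (x : G) :
  quotient_inv (\pi_quotient x) = \pi_quotient (x^-1)%g.
Proof.
rewrite /quotient_inv; unlock; apply/quotient_piP.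
set x' := repr _.
have xx' : (x^-1 * x')%g \in K by apply/quotient_piP; rewrite reprK.
have -> : (x'^-1^-1 * x^-1 = (x^-1 * x') ^ x^-1)%g.
  by rewrite /conjg !invgK !mulgA mulgV mul1g.
exact: conj_closed_subproof.
Qed.

Lemma quotient_oneE : quotient_one = \pi_quotient 1%g.
Proof. by rewrite /quotient_one; unlock. Qed.

Fact quotient_mulA : associative quotient_mul.
Proof.
by elim/quotW=> x; elim/quotW=> y; elim/quotW=> z; rewrite !quotient_mulE mulgA.
Qed.

Fact quotient_mul1 : left_id quotient_one quotient_mul.
Proof. by elim/quotW=> x; rewrite quotient_oneE quotient_mulE mul1g. Qed.

Fact quotient_mulr1 : right_id quotient_one quotient_mul.
Proof. by elim/quotW=> x; rewrite quotient_oneE quotient_mulE mulg1. Qed.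

Fact quotient_mulV : left_inverse quotient_one quotient_inv quotient_mul.
Proof.
by elim/quotW=> x; rewrite quotient_oneE quotient_invE quotient_mulE mulVg.
Qed.

Fact quotient_mulrV : right_inverse quotient_one quotient_inv quotient_mul.
Proof.
by elim/quotW=> x; rewrite quotient_oneE quotient_invE quotient_mulE mulgV.
Qed.

HB.instance Definition _ := isGroup.Build quotient
  quotient_mulA quotient_mul1 quotient_mulr1 quotient_mulV quotient_mulrV.

End QuotientGroup.

Section Hyperbolic.
Variable R : realType.

Definition gromov_product (X : Type) (d : X -> X -> R) (w x y : X) : R :=
  (d x w + d y w - d x y) / 2.

Definition gromov_hyperbolic (X : Type) (d : X -> X -> R) : Prop :=
  exists delta : R, forall w x y z : X,
    Num.min (gromov_product d w x y) (gromov_product d w y z) - delta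
      <= gromov_product d w x z.

Variable H : groupType.

(* x is the product of a word of length n in the letters S and their inverses. *)
Definition word_of_length (S : seq H) (x : H) (n : nat) : Prop :=
  exists w : seq H, [/\ size w = n,
    {in w, forall s, (s \in S) || (s^-1%g \in S)} & (\prod_(s <- w) s)%g = x].

Definition generates (S : seq H) : Prop :=
  forall x : H, exists n, word_of_length S x n.

(* When S generates H, word_norm S x is the least length of a word for x. *)
Definition word_norm (S : seq H) (x : H) : R :=
  inf [set n%:R | n in word_of_length S x].

Definition word_dist (S : seq H) (x y : H) : R := word_norm S (x^-1 * y)%g.

(* Gromov's definition: H is finitely generated, and the word metric of a finite
   generating set is hyperbolic. *)
Definition hyperbolic_group : Prop :=
  exists2 S : seq H, generates S & gromov_hyperbolic (word_dist S).

End Hyperbolic.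

Section Quasimorphism.
Variable R : realType.

Definition defect (G : groupType) (phi : G -> R) : \bar R :=
  ereal_sup [set `|phi p.1 + phi p.2 - phi (p.1 * p.2)%g|%:E | p in [set: G * G]].

Definition quasimorphism (G : groupType) (phi : G -> R) : Prop :=
  (defect phi < +oo)%E.

Definition antisymmetric_fun (G : groupType) (phi : G -> R) : Prop :=
  forall g : G, phi g^-1%g = - phi g.

Variables (G : groupType) (K : groupClosed G).

Definition conjugate_in (x y : G) : Prop := exists g : G, y = (x ^ g)%g.

Definition conj_defect (phi : subgroup K -> R) : \bar R :=
  ereal_sup [set `|phi k.1 - phi k.2|%:E |
    k in [set k : subgroup K * subgroup K | conjugate_in (val k.1) (val k.2)]].

Definition quasi_invariant (phi : subgroup K -> R) : Prop :=
  (conj_defect phi < +oo)%E.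

Definition Qas : set (subgroup K -> R) :=
  [set phi | [/\ quasimorphism phi, antisymmetric_fun phi & quasi_invariant phi]].

End Quasimorphism.

Arguments Qas R {G} K _.

(* Main.v *)
Require Import Defs.
From HB Require Import structures.
From mathcomp Require Import all_boot all_order all_algebra.
From mathcomp Require Import all_classical all_reals ereal.
From mathcomp Require Import zify lra.

(* Lift a finite generating set of G/K to a finite symmetric set of letters in G
   and put Psi(g) = inf_w (phi(w^-1 g) + C |w|), over the words w that represent
   g modulo K.  Replacing a short non-geodesic subword by a geodesic one changes
   the first term by a bounded amount, so for C large it never raises the cost,
   and only locally geodesic words matter.  In a hyperbolic space these stay
   close to geodesics and are never closed unless empty.  Hence Psi = phi on K,
   and Psi is additive up to a constant when g and h concatenate
   quasi-geodesically.  Its antisymmetrization (Psi(g) - Psi(g^-1)) / 2 still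
   restricts to phi because phi is antisymmetric; cutting the triangle 1, g, gh
   at the centre of its approximating tripod, the contributions of the leg
   traversed in both directions cancel, so it is a quasimorphism. *)

Set Implicit Arguments.
Unset Strict Implicit.
Unset Printing Implicit Defensive.

Import Order.TTheory GRing.Theory Num.Theory.

Local Open Scope classical_set_scope.
Local Open Scope ring_scope.
Local Open Scope quotient_scope.

(** * Local geodesics in a discrete hyperbolic space *)

Section LocalGeodesics.
Variable E : nat.

(* The local-to-global argument needs [E < local_scale] and
   [3 * E < 2 * local_scale]. *)
Definition local_scale : nat := (2 * E).+1.

(** Gromov's hyperbolicity inequality with the products expanded, so that distances stay natural
    numbers; [d i j] is meant as the distance between vertices [i] and [j] of a path. *)
Definition four_point (n : nat) (d : nat -> nat -> nat) : Prop :=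
  forall i j k l, (i <= n)%N -> (j <= n)%N -> (k <= n)%N -> (l <= n)%N ->
    (d i k + d l j <= maxn (d i j + d l k) (d j k + d l i) + E)%N.

Definition locally_geodesic (n : nat) (d : nat -> nat -> nat) : Prop :=
  forall i j, (i <= j)%N -> (j <= n)%N -> (j <= i + 2 * local_scale)%N ->
    d i j = (j - i)%N.

Section Forward.
Variables (n : nat) (d : nat -> nat -> nat).
Hypotheses (dC : forall i j, d i j = d j i) (d4 : four_point n d)
  (dl : locally_geodesic n d).

(** Near the start all distances are exact. Further on, apply the four-point condition to
    [i - local_scale], [0], [j], [i]: by induction the distance from [0] has already grown by
    [local_scale - E] on the way to [i], which rules out the first term of the maximum since
    [E < local_scale]; the second term is the claim. *)
Lemma local_geodesic_forward i j :
    (i <= j)%N -> (j <= n)%N -> (j <= i + local_scale)%N ->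
  (d 0 i + (j - i) <= d 0 j + E)%N.
Proof.
elim/ltn_ind: i j => i IH j ij jn jL.
case: (ltnP i local_scale) => iL; first by rewrite !dl //; lia.
have Li : (0 < local_scale)%N by [].
have IHi : (d 0 (i - local_scale) + (i - (i - local_scale)) <= d 0 i + E)%N.
  by apply: IH; lia.
have := @d4 (i - local_scale)%N 0%N j i.
have := @dl (i - local_scale)%N j; have := @dl (i - local_scale)%N i.
have := @dl i j; have := dC i (i - local_scale)%N.
have := dC 0%N (i - local_scale)%N; have := dC 0%N i.
by rewrite /local_scale in jL iL IHi *; lia.
Qed.

End Forward.

Variables (n : nat) (d : nat -> nat -> nat).
Hypotheses (dC : forall i j, d i j = d j i) (d4 : four_point n d)
  (dl : locally_geodesic n d).

(** This is forward progress along the path traversed from [n] to [0]. *)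
Lemma local_geodesic_backward i j :
    (i <= j)%N -> (j <= n)%N -> (j <= i + local_scale)%N ->
  (d n j + (j - i) <= d n i + E)%N.
Proof.
move=> ij jn jL; pose d' i j := d (n - i)%N (n - j)%N.
have := @local_geodesic_forward n d' _ _ _ (n - j)%N (n - i)%N.
rewrite /d' subn0 !subKn; try lia.
move=> H; have {H} := H (fun _ _ => dC _ _).
rewrite (_ : (n - i - (n - j))%N = (j - i)%N); last lia.
apply; try lia.
- by move=> a b c e an bn cn en; apply: d4; lia.
- by move=> a b ab bn bL; rewrite dC dl; lia.
Qed.

(** Apply the four-point condition to [i - local_scale], [0], [n], [i]. Forward and backward
    progress over the segment ending at [i] rule out the first term of the maximum, because
    [3 * E < 2 * local_scale]. *)
Lemma local_geodesic_quasi i : (i <= n)%N -> (d 0 i + d i n <= d 0 n + 2 * E)%N.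
Proof.
move=> i_n; case: (ltnP i local_scale) => iL.
  have := @local_geodesic_backward 0%N i.
  by have := dC n i; have := dC n 0%N; have := @dl 0%N i; lia.
have f : (d 0 (i - local_scale) + (i - (i - local_scale)) <= d 0 i + E)%N.
  by apply: (local_geodesic_forward dC d4 dl); lia.
have b : (d n i + (i - (i - local_scale)) <= d n (i - local_scale) + E)%N.
  by apply: local_geodesic_backward; lia.
have := @d4 (i - local_scale)%N 0%N n i.
have := @dl (i - local_scale)%N i; have := dC i (i - local_scale)%N.
have := dC 0%N (i - local_scale)%N; have := dC n (i - local_scale)%N.
by have := dC n i; have := dC 0%N i; rewrite /local_scale in iL f b *; lia.
Qed.

(** On a long path the last [local_scale] steps already force [d 0 n >= local_scale - E > 0]; on a
    short one [d 0 n] is exactly [n]. *)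
Lemma local_geodesic_loop : d 0 n = 0%N -> n = 0%N.
Proof.
move=> d0; case: (ltnP n local_scale) => nL; first by move: (@dl 0%N n); lia.
have : (d 0 (n - local_scale) + (n - (n - local_scale)) <= d 0 n + E)%N.
  by apply: (local_geodesic_forward dC d4 dl); lia.
by rewrite /local_scale in nL *; lia.
Qed.

End LocalGeodesics.

(** * Words and their values in a group *)

Definition eval_word (G : groupType) (w : seq G) : G := (\prod_(t <- w) t)%g.

Definition inv_word (G : groupType) (w : seq G) : seq G :=
  rev [seq t^-1%g | t <- w].

Section Words.
Variable G : groupType.
Implicit Types (u v w : seq G) (g h : G).

Lemma eval_word_nil : eval_word [::] = 1%g :> G.
Proof. by rewrite /eval_word big_nil. Qed.

Lemma eval_word_cat u v : eval_word (u ++ v) = (eval_word u * eval_word v)%g.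
Proof. by rewrite /eval_word big_cat. Qed.

Lemma eval_word_cons g w : eval_word (g :: w) = (g * eval_word w)%g.
Proof. by rewrite /eval_word big_cons. Qed.

Lemma eval_inv_word w : eval_word (inv_word w) = (eval_word w)^-1%g.
Proof.
elim: w => [|g w IH]; first by rewrite /inv_word /= eval_word_nil invg1.
rewrite /inv_word /= rev_cons -cats1 eval_word_cat -/(inv_word w) IH.
by rewrite !eval_word_cons eval_word_nil mulg1 invgM.
Qed.

Lemma size_inv_word w : size (inv_word w) = size w.
Proof. by rewrite size_rev size_map. Qed.

(** Only finitely many words are involved. In the induction the first letter is absorbed into a
    translate of [f], and summing the bounds over [T] covers every choice of that letter. *)
Lemma bounded_on_words (R : realType) (T : seq G) n (f : G -> R) :
  exists M, forall w, {subset w <= T} -> (size w <= n)%N ->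
    `|f (eval_word w)| <= M.
Proof.
elim: n f => [|n IH] f.
  exists `|f 1%g| => w _; rewrite leqn0 size_eq0 => /eqP->.
  by rewrite eval_word_nil.
have [M HM] := choice (fun t => IH (fun g => f (t * g)%g)).
have sum_ge0 s : 0 <= \sum_(t <- s) `|M t| by apply: sumr_ge0.
exists (`|f 1%g| + \sum_(t <- T) `|M t|) => -[|t w] wT sw.
  by rewrite eval_word_nil lerDl.
rewrite eval_word_cons.
have tT : t \in T by apply: wT; rewrite mem_head.
apply: (le_trans (HM t w _ sw)) => [s sw'|].
  by apply: wT; rewrite inE sw' orbT.
rewrite (big_rem t tT) /= addrCA (le_trans (ler_norm _))// lerDl.
by rewrite addr_ge0.
Qed.

End Words.

(** * Word length and word metric modulo a normal subgroup *)

Section CosetLength.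
Variables (G : groupType) (K : normalClosed G) (T : seq G).
Hypothesis TV : forall t, t \in T -> t^-1%g \in T.
Implicit Types (u v w : seq G) (g h : G).

Definition spells w g : Prop :=
  {subset w <= T} /\ ((eval_word w)^-1 * g)%g \in K.

Lemma normal_conj x g : x \in K -> (x ^ g)%g \in K.
Proof. exact: conj_closed_subproof. Qed.

Lemma spells_nil g : g \in K -> spells [::] g.
Proof. by move=> gK; split=> //; rewrite eval_word_nil invg1 mul1g. Qed.

Lemma spells_eval w : {subset w <= T} -> spells w (eval_word w).
Proof. by move=> wT; split=> //; rewrite mulVg gpred1. Qed.

Lemma spells_cat u v g h :
  spells u g -> spells v h -> spells (u ++ v) (g * h)%g.
Proof.
move=> [uT uK] [vT vK]; split=> [t|].
  by rewrite mem_cat => /orP[/uT|/vT].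
have -> : ((eval_word (u ++ v))^-1 * (g * h) =
    ((eval_word u)^-1 * g) ^ (eval_word v) * ((eval_word v)^-1 * h))%g.
  by rewrite eval_word_cat /conjg !(invgM, mulgA, mulgK).
by rewrite gpredM// normal_conj.
Qed.

Lemma spells_inv w g : spells w g -> spells (inv_word w) g^-1%g.
Proof.
move=> [wT wK]; split=> [t|].
  by rewrite mem_rev => /mapP[s /wT sT ->]; apply: TV.
rewrite eval_inv_word invgK.
have -> : (eval_word w * g^-1 = ((eval_word w)^-1 * g)^-1 ^ (eval_word w)^-1)%g.
  by rewrite /conjg !(invgM, invgK, mulgA, mulgV, mul1g, mulgK, mulgVK).
by rewrite normal_conj// gpredV.
Qed.

Lemma spells_mod w g h : spells w g -> (g^-1 * h)%g \in K -> spells w h.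
Proof.
move=> [wT wK] gh; split=> //.
by have := gpredM _ _ wK gh; rewrite mulgA mulgK.
Qed.

Variable len : G -> nat.
Hypotheses (len_word : forall g, exists2 w, spells w g & size w = len g)
  (len_le : forall w g, spells w g -> (len g <= size w)%N).

Lemma len_modr g h : (g^-1 * h)%g \in K -> len g = len h.
Proof.
move=> gh; apply/eqP; rewrite eqn_leq; apply/andP; split.
  have [w wh <-] := len_word h; apply/len_le/(spells_mod wh).
  by rewrite -gpredV invgM invgK.
by have [w wg <-] := len_word g; apply/len_le/(spells_mod wg).
Qed.

Lemma lenV g : len g^-1%g = len g.
Proof.
have le h : (len h^-1%g <= len h)%N.
  have [w wh <-] := len_word h.
  by rewrite -(size_inv_word w); apply/len_le/spells_inv.
by apply/eqP; rewrite eqn_leq le -{1}(invgK g) le.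
Qed.

Lemma lenM g h : (len (g * h)%g <= len g + len h)%N.
Proof.
have [u ug <-] := len_word g; have [v vh <-] := len_word h.
by rewrite -size_cat; apply/len_le/spells_cat.
Qed.

Lemma len_eq0 g : g \in K -> len g = 0%N.
Proof. by move=> /spells_nil /len_le; rewrite leqn0 => /eqP. Qed.

(** The word metric of the quotient pulled back to [G]: a pseudometric that vanishes inside each
    coset. *)
Definition dist g h : nat := len (g^-1 * h)%g.

Lemma distC g h : dist g h = dist h g.
Proof. by rewrite /dist -lenV invgM invgK. Qed.

Lemma dist1 g : dist 1%g g = len g.
Proof. by rewrite /dist invg1 mul1g. Qed.

Lemma dist_modr x g h : (g^-1 * h)%g \in K -> dist x g = dist x h.
Proof.
by move=> gh; apply: len_modr; rewrite invgM invgK mulgA mulgK.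
Qed.

Lemma dist_triangle y x z : (dist x z <= dist x y + dist y z)%N.
Proof. by rewrite (leq_trans _ (lenM _ _))// /dist mulgA mulgK. Qed.

Definition word_locally_geodesic n w : Prop :=
  forall u v u', w = u ++ v ++ u' -> (size v <= n)%N ->
    (size v <= len (eval_word v))%N.

Lemma dist_take w i j : (i <= j)%N ->
  dist (eval_word (take i w)) (eval_word (take j w)) =
  len (eval_word (drop i (take j w))).
Proof.
move=> ij; rewrite /dist -{1}(cat_take_drop i (take j w)) eval_word_cat.
by rewrite take_takel// mulKg.
Qed.

Variable E : nat.
Hypothesis dist4 : forall t x y z,
  (dist x z + dist t y <=
   maxn (dist x y + dist t z) (dist y z + dist t x) + E)%N.

(** * Locally geodesic words as paths in the quotient *)

Section Vertices.
Variable w : seq G.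
Hypotheses (wT : {subset w <= T})
  (wl : word_locally_geodesic (2 * local_scale E) w).

Let d i j := dist (eval_word (take i w)) (eval_word (take j w)).

Let d_local : locally_geodesic E (size w) d.
Proof.
move=> i j ij jw jL; rewrite /d dist_take//; set v := drop i _.
have sv : size v = (j - i)%N by rewrite size_drop size_takel.
apply/eqP; rewrite eqn_leq; apply/andP; split.
  rewrite -sv; apply/len_le/spells_eval => t /mem_drop /mem_take; exact: wT.
rewrite -{1}sv; apply: (@wl (take i w) v (drop j w)); last by rewrite sv; lia.
by rewrite /v -(take_takel w ij) catA !cat_take_drop.
Qed.

Let d_four : four_point E (size w) d.
Proof. by move=> i j k l _ _ _ _; apply: dist4. Qed.

Lemma local_geodesic_word_quasi i :
  (dist 1%g (eval_word (take i w)) + dist (eval_word (take i w)) (eval_word w)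
     <= len (eval_word w) + 2 * E)%N.
Proof.
case: (leqP i (size w)) => [iw|/ltnW wi]; last first.
  by rewrite take_oversize// dist1 /dist mulVg (len_eq0 gpred1); lia.
have := local_geodesic_quasi (fun _ _ => distC _ _) d_four d_local iw.
by rewrite /d take0 take_size eval_word_nil !dist1.
Qed.

Lemma local_geodesic_word_loop : eval_word w \in K -> w = [::].
Proof.
move=> wK; apply: size0nil.
apply: (local_geodesic_loop (fun _ _ => distC _ _) d_four d_local).
by rewrite /d take0 take_size eval_word_nil dist1 len_eq0.
Qed.

(** Pick a prefix about as far from [1] as [g1]. It and [g1] both lie almost on a geodesic from [1]
    to [g], so the four-point condition puts them close together. *)
Lemma local_geodesic_word_near c g1 g :
    spells w g -> (len g1 + dist g1 g <= len g + c)%N ->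
  exists i, (dist g1 (eval_word (take i w)) <= 3 * E + 2 * c)%N.
Proof.
move=> [_ wg] g1g.
have wlen : len (eval_word w) = len g by apply: len_modr.
have [i [iw il iu]] : exists i, [/\ (i <= size w)%N,
    (len (eval_word (take i w)) <= len g1)%N
  & (len g1 <= len (eval_word (take i w)) + c)%N].
  (* Take the last prefix no longer than [g1]. One more letter adds at most 1 to the length, so the
     two lengths agree, unless [w] is exhausted, where they differ by at most [c]. *)
  pose P i := (i <= size w)%N && (len (eval_word (take i w)) <= len g1)%N.
  have P0 : exists i, P i.
    by exists 0%N; rewrite /P take0 eval_word_nil (len_eq0 gpred1).
  have Pub i : P i -> (i <= size w)%N by case/andP.
  case: (ex_maxnP P0 Pub) => i /andP[iw il] imax; exists i; split=> //.
  case: (ltnP i (size w)) => [iw'|wi]; last first.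
    by rewrite take_oversize// wlen; lia.
  have : ~~ P i.+1 by apply/negP => /imax; rewrite ltnn.
  rewrite /P iw' /= -ltnNge => lt.
  have := dist_triangle (eval_word (take i w)) 1%g (eval_word (take i.+1 w)).
  by rewrite !dist1 -/(d i i.+1) d_local ?/local_scale; lia.
exists i; have := local_geodesic_word_quasi i.
rewrite dist1 wlen (dist_modr _ wg).
have := dist4 1%g g1 g (eval_word (take i w)).
have := distC (eval_word (take i w)) g.
by rewrite !dist1; lia.
Qed.

End Vertices.

(** * The cost of a word and its infimum *)

Section Cost.
Variables (R : realType) (f : G -> R) (D C : R).
Hypotheses
  (fM : forall x y, x \in K -> y \in K -> `|f (x * y)%g - f x - f y| <= D)
  (fJ : forall x y, x \in K -> `|f (x ^ y)%g - f x| <= D)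
  (fV : forall x, x \in K -> f x^-1%g = - f x)
  (C_large : forall w, {subset w <= T} -> (size w <= 4 * local_scale E)%N ->
     eval_word w \in K -> `|f (eval_word w)| + 2 * D <= C).

Definition cost w g : R := f ((eval_word w)^-1 * g)%g + C * (size w)%:R.

Definition min_cost g : R := inf [set cost w g | w in [set w | spells w g]].

Lemma defect_ge0 : 0 <= D.
Proof. exact: le_trans (fM (gpred1 (s := K)) gpred1). Qed.

Lemma cost_slope_ge0 : 0 <= C.
Proof.
have := @C_large [::]; rewrite eval_word_nil => /(_ _ _ gpred1) => H.
apply: le_trans (H _ _) => //.
by rewrite addr_ge0// mulr_ge0// defect_ge0.
Qed.

Lemma quasi_add x y g : x \in K -> y \in K ->
  `|f (x ^ g * y)%g - f x - f y| <= 2 * D.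
Proof.
move=> xK yK.
have := fM (normal_conj g xK) yK; have := fJ g xK.
by rewrite !ler_norml => /andP[? ?] /andP[? ?]; apply/andP; split; lra.
Qed.

Lemma cost_cat u v g h : spells u g -> spells v h ->
  cost (u ++ v) (g * h)%g <= cost u g + cost v h + 2 * D.
Proof.
move=> [_ uK] [_ vK]; rewrite /cost size_cat natrD.
have -> : ((eval_word (u ++ v))^-1 * (g * h) =
    ((eval_word u)^-1 * g) ^ (eval_word v) * ((eval_word v)^-1 * h))%g.
  by rewrite eval_word_cat /conjg !(invgM, mulgA, mulgK).
have := quasi_add (eval_word v) uK vK.
by rewrite ler_norml => /andP[? ?]; lra.
Qed.

(** The path [u ++ v] is cut after [u] and the detour [t] to [g] is walked there and back, whence
    [2 * C * size t]. The two remainders in [K] involve [a] and a conjugate of [a^-1], so their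
    contributions cancel by [fV] up to [2 * D]. *)
Lemma cost_split u t v g h :
    spells (u ++ v) h -> spells (u ++ t) g ->
  cost (u ++ t) g + cost (inv_word t ++ v) (g^-1 * h)%g <=
    cost (u ++ v) h + 2 * C * (size t)%:R + 2 * D.
Proof.
move=> [_ hK] [_ gK]; rewrite /cost !size_cat size_inv_word !natrD.
set a := ((eval_word (u ++ t))^-1 * g)%g.
set b := ((eval_word (u ++ v))^-1 * h)%g.
have -> : ((eval_word (inv_word t ++ v))^-1 * (g^-1 * h) =
    a^-1 ^ ((eval_word t)^-1 * eval_word v) * b)%g.
  rewrite /a /b !eval_word_cat eval_inv_word /conjg.
  by rewrite !(invgM, invgK, mulgA, mulgV, mulVg, mul1g, mulgK, mulgVK).
have aK : (a^-1)%g \in K by rewrite gpredV.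
have := quasi_add ((eval_word t)^-1 * eval_word v)%g aK hK.
by rewrite fV// ler_norml => /andP[? ?]; lra.
Qed.

(* Each shortcut saves at least [C], which by [C_large] outweighs the change
   of [f]; induct on the size of the word. *)
Lemma cost_reduce w g : spells w g ->
  exists w', [/\ spells w' g, word_locally_geodesic (2 * local_scale E) w'
    & cost w' g <= cost w g].
Proof.
have [n] := ubnP (size w); elim: n w => // n IH w wn wg.
have [wl|] := pselect (word_locally_geodesic (2 * local_scale E) w).
  by exists w.
move=> /existsNP[u] /existsNP[v] /existsNP[u'] /not_implyP[wE].
move=> /not_implyP[vL] /negP; rewrite -ltnNge => vlen.
have [wT wK] := wg.
have uT : {subset u <= T} by move=> t tu; apply: wT; rewrite wE !mem_cat tu.
have vT : {subset v <= T}.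
  by move=> t tv; apply: wT; rewrite wE !mem_cat tv orbT.
have u'T : {subset u' <= T}.
  by move=> t tu; apply: wT; rewrite wE !mem_cat tu !orbT.
have [v' v'v sv'] := len_word (eval_word v).
pose w1 := u ++ v' ++ u'.
have w1w : ((eval_word w1)^-1 * g =
    ((eval_word v')^-1 * eval_word v) ^ eval_word u' *
    ((eval_word w)^-1 * g))%g.
  rewrite wE /w1 !eval_word_cat /conjg.
  by rewrite !(invgM, invgK, mulgA, mulgV, mulVg, mul1g, mulgK, mulgVK).
have [v'T v'K] := v'v.
have w1g : spells w1 g.
  split; last by rewrite w1w gpredM// normal_conj.
  by move=> t; rewrite !mem_cat => /or3P[/uT|/v'T|/u'T].
have [|w' [w'g w'l w'c]] := IH w1 _ w1g.
  by move: wn; rewrite wE /w1 !size_cat; lia.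
exists w'; split=> //; apply: (le_trans w'c).
rewrite /cost w1w.
have := quasi_add (eval_word u') v'K wK.
(* The loop formed by [v] and its shortcut has at most [2 * local_scale E] letters on each side,
   hence the [4 * local_scale E] in [C_large]. *)
have := @C_large (inv_word v' ++ v).
rewrite eval_word_cat eval_inv_word => H.
have {H} : `|f ((eval_word v')^-1 * eval_word v)%g| + 2 * D <= C.
  apply: H => //; last by rewrite size_cat size_inv_word; lia.
  move=> t; rewrite mem_cat => /orP[|/vT//].
  by rewrite mem_rev => /mapP[s /v'T sT ->]; apply: TV.
have sw : (size w1)%:R + 1 <= (size w)%:R :> R.
  by rewrite natr1 ler_nat wE /w1 !size_cat; lia.
have := ler_wpM2l cost_slope_ge0 sw; rewrite mulrDr mulr1.
set x := f _ => Cs; rewrite -lerBrDr ler_norml => /andP[? ?].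
by rewrite ler_norml => /andP[? ?]; lra.
Qed.

(** The reduced word is locally geodesic and closed in the quotient, hence empty, and the empty word
    costs exactly [f k]. *)
Lemma cost_ge_on_kernel w k : k \in K -> spells w k -> f k <= cost w k.
Proof.
move=> kK /cost_reduce[w' [w'k w'l le]]; apply: le_trans le.
have [w'T w'K] := w'k.
have -> : w' = [::].
  apply: local_geodesic_word_loop => //.
  by have := gpredF w'K kK; rewrite mulgK gpredV.
by rewrite /cost eval_word_nil invg1 mul1g mulr0 addr0.
Qed.

Lemma costs_nonempty g :
  [set cost w g | w in [set w | spells w g]] !=set0.
Proof. by have [w wg _] := len_word g; exists (cost w g), w. Qed.

(** Makes the infimum in [min_cost] genuine. Appending a fixed word for [g^-1] gives a word for [1],
    whose cost is at least [f 1]. *)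
Lemma costs_lbound g : has_lbound [set cost w g | w in [set w | spells w g]].
Proof.
have [v vg _] := len_word g^-1%g.
exists (f 1%g - cost v g^-1%g - 2 * D) => _ [w wg <-].
have := cost_ge_on_kernel gpred1.
have := spells_cat wg vg; rewrite mulgV => + H => /H.
by have := cost_cat wg vg; rewrite mulgV; lra.
Qed.

Lemma min_cost_le w g : spells w g -> min_cost g <= cost w g.
Proof. by move=> wg; apply: (ge_inf (costs_lbound g)); exists w. Qed.

(** The infimum need not be attained, hence the slack 1; [cost_reduce] makes a near-minimizer
    locally geodesic at no extra cost. *)
Lemma min_cost_near g : exists w, [/\ spells w g,
  word_locally_geodesic (2 * local_scale E) w & cost w g < min_cost g + 1].
Proof.
have [_ [w wg <-] lt] := inf_adherent (@ltr01 R)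
  (conj (costs_nonempty g) (costs_lbound g)).
have [w' [w'g w'l le]] := cost_reduce wg.
by exists w'; split=> //; apply: le_lt_trans lt.
Qed.

Lemma min_cost_kernel k : k \in K -> min_cost k = f k.
Proof.
move=> kK; apply/eqP; rewrite eq_le; apply/andP; split.
  have := min_cost_le (spells_nil kK).
  by rewrite /cost eval_word_nil invg1 mul1g mulr0 addr0.
apply: (lb_le_inf (costs_nonempty k)) => _ [w wk <-].
exact: cost_ge_on_kernel.
Qed.

(** Concatenate near-minimizers for [g] and [h]; each brings a slack of 1. *)
Lemma min_costM g h : min_cost (g * h)%g <= min_cost g + min_cost h + 2 * D + 2.
Proof.
have [u [ug _ uc]] := min_cost_near g; have [v [vh _ vc]] := min_cost_near h.
have := min_cost_le (spells_cat ug vh); have := cost_cat ug vh; lra.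
Qed.

(** The converse of [min_costM] when [g] is almost on a geodesic from [1] to [g * h]: a locally
    geodesic near-minimizer for [g * h] passes near [g] and can be split there by a short detour
    [t]. *)
Lemma min_cost_split c g h : (len g + len h <= len (g * h)%g + c)%N ->
  min_cost g + min_cost h <=
    min_cost (g * h)%g + 1 + 2 * C * (3 * E + 2 * c)%:R + 2 * D.
Proof.
move=> gh; have [w [wg wl wc]] := min_cost_near (g * h)%g.
have [wT wK] := wg.
have gd : (len g + dist g (g * h)%g <= len (g * h)%g + c)%N.
  by rewrite /dist mulKg.
have [i near] := local_geodesic_word_near wT wl wg gd.
pose u := take i w; pose v := drop i w.
have uT : {subset u <= T} by move=> t /mem_take/wT.
have vT : {subset v <= T} by move=> t /mem_drop/wT.
rewrite -/u distC in near.
have [t tg tsz] := len_word ((eval_word u)^-1 * g)%g.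
have utg : spells (u ++ t) g.
  by have := spells_cat (spells_eval uT) tg; rewrite mulVKg.
have uv : u ++ v = w by exact: cat_take_drop.
have wg' : spells (u ++ v) (g * h)%g by rewrite uv.
have tvh : spells (inv_word t ++ v) h.
  have gw : spells v ((eval_word u)^-1 * (g * h))%g.
    split=> //; rewrite -uv eval_word_cat in wK.
    by rewrite invgM -!mulgA in wK *.
  have := spells_cat (spells_inv tg) gw.
  by rewrite invgM invgK !mulgA mulgK mulVg mul1g.
have := cost_split wg' utg; rewrite mulKg uv.
have := min_cost_le utg; have := min_cost_le tvh.
have : C * (size t)%:R <= C * (3 * E + 2 * c)%:R.
  by rewrite ler_wpM2l ?cost_slope_ge0// ler_nat tsz.
lra.
Qed.

(** * Antisymmetrization and the tripod argument *)

Definition skew_min_cost g : R := (min_cost g - min_cost g^-1%g) / 2.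

Lemma skew_min_costV g : skew_min_cost g^-1%g = - skew_min_cost g.
Proof. by rewrite /skew_min_cost invgK; lra. Qed.

Lemma skew_min_cost_kernel k : k \in K -> skew_min_cost k = f k.
Proof.
move=> kK; rewrite /skew_min_cost !min_cost_kernel ?gpredV// fV//; lra.
Qed.

(** The hypothesis is symmetric under inversion, so [min_costM] and [min_cost_split] give two-sided
    estimates for both [g * h] and [h^-1 * g^-1]; take half the difference. *)
Lemma skew_min_cost_split c g h : (len g + len h <= len (g * h)%g + c)%N ->
  `|skew_min_cost (g * h)%g - skew_min_cost g - skew_min_cost h| <=
    2 + 2 * C * (3 * E + 2 * c)%:R + 2 * D.
Proof.
move=> gh.
have hg : (len h^-1%g + len g^-1%g <= len (h^-1 * g^-1)%g + c)%N.
  by rewrite -invgM !lenV addnC.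
have := min_cost_split gh; have := min_cost_split hg.
have := min_costM g h; have := min_costM h^-1%g g^-1%g.
have := mulr_ge0 cost_slope_ge0 (ler0n R (3 * E + 2 * c)).
have := defect_ge0; rewrite /skew_min_cost invgM ler_norml.
by move=> *; apply/andP; split; lra.
Qed.

(** The point [m] lies on a geodesic from [1] to [g], where the side towards [g * h] branches off,
    so it is almost on all three sides of the triangle [1], [g], [g * h]. *)
Lemma tripod_center g h : exists m,
  [/\ (len m + dist m g <= len g + E.+1)%N,
      (dist m g + dist m (g * h)%g <= len h + E.+1)%N
    & (len m + dist m (g * h)%g <= len (g * h)%g + E.+1)%N].
Proof.
have [w [wT wK] sw] := len_word g.
have gE : (dist g (g * h)%g = len h)%N by rewrite /dist mulKg.
have wlen : len (eval_word w) = len g by apply: len_modr.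
(* [s] is the Gromov product of [g] and [g * h] at [1], rounded down; the rounding accounts for
   [E.+1] instead of [E]. *)
pose s := ((len g + len (g * h)%g - len h) %/ 2)%N.
have t1 := dist_triangle g 1%g (g * h)%g.
have t2 := dist_triangle (g * h)%g 1%g g.
have t3 := dist_triangle 1%g g (g * h)%g.
have gC := distC g 1%g; have ghC := distC g (g * h)%g.
rewrite !dist1 gE in t1 t2 t3 gC ghC.
have slen : (s <= size w)%N by rewrite /s sw; lia.
pose m := eval_word (take s w); exists m.
have mlen : (len m <= s)%N.
  rewrite -(size_takel slen); apply/len_le/spells_eval => t /mem_take.
  exact: wT.
have mg : (dist m g <= len g - s)%N.
  rewrite -(dist_modr m wK) -sw -(size_drop s w) /dist.
  rewrite -{1}(cat_take_drop s w) eval_word_cat mulKg.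
  by apply/len_le/spells_eval => t /mem_drop; exact: wT.
have := dist4 1%g m g (g * h)%g; have := distC m 1%g.
by rewrite !dist1 gE /s in mlen mg slen *; split; lia.
Qed.

(** Each side splits at [m] into two legs with error [B]. Every leg occurs twice in the sum, and
    antisymmetry cancels the leg [m^-1 * g], which occurs in both directions. *)
Lemma skew_min_cost_quasi : exists B, forall g h,
  `|skew_min_cost g + skew_min_cost h - skew_min_cost (g * h)%g| <= B.
Proof.
pose B := 2 + 2 * C * (3 * E + 2 * E.+1)%:R + 2 * D.
exists (B + B + B) => g h.
have [m [mg gmh mgh]] := tripod_center g h.
have e1 : (m * (m^-1 * g) = g)%g by rewrite mulVKg.
have e2 : ((m^-1 * g)^-1 * (m^-1 * (g * h)) = h)%g.
  by rewrite invgM invgK !mulgA mulgK mulVg mul1g.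
have e3 : (m * (m^-1 * (g * h)) = g * h)%g by rewrite mulVKg.
have := @skew_min_cost_split E.+1 m (m^-1 * g)%g.
have := @skew_min_cost_split E.+1 (m^-1 * g)^-1%g (m^-1 * (g * h))%g.
have := @skew_min_cost_split E.+1 m (m^-1 * (g * h))%g.
rewrite e1 e2 e3 skew_min_costV lenV => /(_ mgh) + /(_ gmh) + /(_ mg).
rewrite -/B !ler_norml => /andP[? ?] /andP[? ?] /andP[? ?].
by apply/andP; split; lra.
Qed.

End Cost.

End CosetLength.

Lemma ereal_sup_lty_bound (R : realType) (I : Type) (A : set I) (h : I -> R) :
  (ereal_sup [set (h i)%:E | i in A] < +oo)%E ->
  exists B, forall i, A i -> h i <= B.
Proof.
move: (@ereal_sup_ubound R [set (h i)%:E | i in A]).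
case: ereal_sup => [B| |] ub // _.
  by exists B => i Ai; rewrite -lee_fin; apply: ub; exists i.
(* A supremum equal to [-oo] forces [A] to be empty, so any bound will do. *)
exists 0 => i Ai; have : ((h i)%:E <= -oo)%E by apply: ub; exists i.
by rewrite leeNy_eq.
Qed.

(** * From the word metric of the quotient to a length on [G] *)

Section QuotientLength.
Variables (G : groupType) (K : normalClosed G).

Lemma piM (x y : G) :
  \pi_(quotient K) (x * y)%g = (\pi_(quotient K) x * \pi_(quotient K) y)%g.
Proof. by rewrite -quotient_mulE. Qed.

Lemma piV (x : G) : \pi_(quotient K) (x^-1)%g = (\pi_(quotient K) x)^-1%g.
Proof. by rewrite -quotient_invE. Qed.

Lemma pi_eval_word (w : seq G) :
  \pi_(quotient K) (eval_word w) = (\prod_(t <- w) \pi_(quotient K) t)%g.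
Proof.
elim: w => [|t w IH]; first by rewrite eval_word_nil big_nil -quotient_oneE.
by rewrite eval_word_cons big_cons piM IH.
Qed.

Variable S : seq (quotient K).

Definition letters : seq G := map repr S ++ [seq (repr s)^-1%g | s <- S].

Lemma lettersV t : t \in letters -> t^-1%g \in letters.
Proof.
rewrite !mem_cat => /orP[] /mapP[s sS ->]; last by rewrite invgK map_f.
by rewrite (map_f (fun s => (repr s)^-1%g)) ?orbT.
Qed.

Lemma pi_letters t : t \in letters ->
  (\pi_(quotient K) t \in S) || ((\pi_(quotient K) t)^-1%g \in S).
Proof.
rewrite mem_cat => /orP[] /mapP[s sS ->]; first by rewrite reprK sS.
by rewrite -piV invgK reprK sS orbT.
Qed.

Lemma spells_word_of_length g n :
  word_of_length S (\pi_(quotient K) g) n <->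
  exists2 w, spells K letters w g & size w = n.
Proof.
split=> [[w [<- wS wg]]|[w [wT wg] <-]]; last first.
  exists (map \pi_(quotient K) w); split; first by rewrite size_map.
    by move=> _ /mapP[t /wT tT ->]; apply: pi_letters.
  by rewrite big_map -pi_eval_word; apply/quotient_piP.
(* A letter of the word outside [S] has its inverse in [S], so its lift is in [letters] in either
   case. *)
pose lift (s : quotient K) : G :=
  if s \in S then repr s else (repr s^-1%g)^-1%g.
have liftK s : \pi_(quotient K) (lift s) = s.
  by rewrite /lift; case: ifP => _; rewrite ?piV reprK ?invgK.
exists (map lift w); last by rewrite size_map.
split.
  move=> _ /mapP[s /wS sS ->]; rewrite /lift mem_cat.
  case: ifP sS => /= [sS _|_ sS]; first by rewrite map_f.
  by rewrite (map_f (fun s => (repr s)^-1%g)) ?orbT.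
apply/quotient_piP; rewrite pi_eval_word big_map -wg.
by apply: eq_bigr => s _; rewrite liftK.
Qed.

(** The infimum in [word_norm] runs over a nonempty set of natural numbers, so it is attained and
    the real norm is a natural number. *)
Lemma coset_length_exists (R : realType) : generates S ->
  exists len : G -> nat,
    [/\ forall g, exists2 w, spells K letters w g & size w = len g,
        forall w g, spells K letters w g -> (len g <= size w)%N
      & forall g, word_norm R S (\pi_(quotient K) g) = (len g)%:R].
Proof.
move=> Sgen.
have ex g : exists n, `[< exists2 w, spells K letters w g & size w = n >].
  by have [n /spells_word_of_length ?] := Sgen (\pi_(quotient K) g);
     exists n; apply/asboolP.
exists (fun g => ex_minn (ex g)); split=> [g|w g wg|g].
- by case: ex_minnP => n /asboolP.
- by case: ex_minnP => n _; apply; apply/asboolP; exists w.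
case: ex_minnP => n /asboolP nw nmin; rewrite /word_norm.
have nlb : lbound [set m%:R | m in word_of_length S (\pi_(quotient K) g)]
    (n%:R : R).
  move=> _ [m /spells_word_of_length mw <-].
  by rewrite ler_nat nmin//; apply/asboolP.
have nin : [set m%:R | m in word_of_length S (\pi_(quotient K) g)] (n%:R : R).
  by exists n => //; apply/spells_word_of_length.
apply/eqP; rewrite eq_le; apply/andP; split.
  by apply: ge_inf => //; exists n%:R.
by apply: lb_le_inf => //; exists n%:R.
Qed.

Lemma four_point_of_hyperbolic (R : realType) (len : G -> nat) :
    (forall g, word_norm R S (\pi_(quotient K) g) = (len g)%:R) ->
    (forall g h, dist len g h = dist len h g) ->
    gromov_hyperbolic (@word_dist R _ S) ->
  exists E, forall t x y z,
    (dist len x z + dist len t y <=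
     maxn (dist len x y + dist len t z) (dist len y z + dist len t x) + E)%N.
Proof.
move=> lenE dC [delta hyp].
have dE x y : word_dist R S (\pi_(quotient K) x) (\pi_(quotient K) y)
    = (dist len x y)%:R by rewrite /word_dist -piV -piM lenE.
(* Clearing the denominator 2 of the Gromov products doubles [delta]; [E] is a natural number above
   [2 * delta]. *)
exists (Num.truncn (2 * delta)).+1 => t x y z.
have := truncnS_gt (2 * delta); set n := (Num.truncn _).+1 => bnd.
have := hyp (\pi_(quotient K) t) (\pi_(quotient K) x) (\pi_(quotient K) y)
  (\pi_(quotient K) z).
rewrite /gromov_product !dE !(dC _ t) lerBlDr ge_min => /orP[] H.
  have : (dist len x z + dist len t y <= dist len x y + dist len t z + n)%N.
    by rewrite -(ler_nat R) !natrD; lra.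
  by lia.
have : (dist len x z + dist len t y <= dist len y z + dist len t x + n)%N.
  by rewrite -(ler_nat R) !natrD; lra.
by lia.
Qed.

End QuotientLength.

(** * Construction of the extension *)

Theorem corollary1p5 (R : realType) (G : groupType) (K : normalClosed G)
    (hyp : hyperbolic_group R (quotient K)) (phi : subgroup K -> R)
    (phiK : Qas R K phi) :
  exists Phi : G -> R,
    quasimorphism Phi /\ (forall k : subgroup K, Phi (val k) = phi k).
Proof.
have [S Sgen Shyp] := hyp.
have [len [len_word len_le lenE]] := coset_length_exists R Sgen.
have lC := distC (@lettersV _ _ S) len_word len_le.
have [E dist4] := four_point_of_hyperbolic lenE lC Shyp.
have [/ereal_sup_lty_bound[D1 phiM] phiV /ereal_sup_lty_bound[D2 phiJ]] := phiK.
(* The value 0 off [K] is a mere default: the conditions imposed on [f] concern elements of [K]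
   only. *)
pose f g := if insub g is Some k then phi k else 0.
have fE k : f (val k) = phi k by rewrite /f valK.
have fM x y : x \in K -> y \in K ->
    `|f (x * y)%g - f x - f y| <= Num.max D1 D2.
  move=> xK yK; rewrite -[x]/(val (Subgroup xK)) -[y]/(val (Subgroup yK)).
  rewrite -valM !fE le_max; apply/orP; left.
  rewrite -normrN; apply: le_trans (phiM (Subgroup xK, Subgroup yK) _) => //=.
  by rewrite !opprB addrA [X in `|X - _|]addrC.
have fJ x y : x \in K -> `|f (x ^ y)%g - f x| <= Num.max D1 D2.
  move=> xK; have xyK := normal_conj y xK.
  rewrite -[x]/(val (Subgroup xK)) -[(_ ^ y)%g]/(val (Subgroup xyK)) !fE.
  rewrite le_max; apply/orP; right; rewrite distrC.
  by apply: (phiJ (Subgroup xK, Subgroup xyK)); exists y.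
have fV x : x \in K -> f x^-1%g = - f x.
  by move=> xK; rewrite -[x]/(val (Subgroup xK)) fE -phiV -fE gmulfV.
have [M fB] := bounded_on_words (letters S) (4 * local_scale E) f.
(* [M] pays for the value of [f] on a shortcut loop, the other term for one use each of
   near-additivity and quasi-invariance. *)
pose C := M + 2 * Num.max D1 D2.
have C_large w : {subset w <= letters S} -> (size w <= 4 * local_scale E)%N ->
    eval_word w \in K -> `|f (eval_word w)| + 2 * Num.max D1 D2 <= C.
  by move=> wT ws _; rewrite lerD2r fB.
have lV := @lettersV _ _ S.
exists (skew_min_cost K (letters S) f C); split=> [|k]; last first.
  rewrite -fE; apply: (skew_min_cost_kernel lV len_word len_le dist4 fM fJ fV);
    by [exact: C_large | exact: valP].
have [B PhiB] := skew_min_cost_quasi lV len_word len_le dist4 fM fJ fV C_large.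
apply: le_lt_trans (ltry B); apply: ub_ereal_sup => _ [p _ <-].
by rewrite lee_fin.
Qed.
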